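(* Let $X$ be a topological space and let $\mathcal A=\{A_i\}_{i\in I}$ be a finite collection of closed subsets $A_i\subseteq X^{S_i}$, where each $S_i$ is a finite set. Assume that no $A_i$ contains a coordinate axis: for every $i\in I$, every $s\in S_i$ and every $\bar x\in X^{S_i-\{s\}}$, one has, under the identification $X^{S_i}\cong X^{S_i-\{s\}}\times X$, $$\{\bar x\}\times X\not\subseteq A_i .$$ Let $S$ be a finite set and let $1$ denote a one-element set. Then the multiplication $$P_{\mathcal A}(S)\times\{\hat 0\}\subset P_{\mathcal A}(S)\times P_{\mathcal A}(1)\longrightarrow P_{\mathcal A}(S\sqcup 1)$$ identifies $P_{\mathcal A}(S)$ with an order ideal (that is, a downwards closed subset) of $P_{\mathcal A}(S\sqcup 1)$.
   Context: For a finite set $T$, an index $i\in I$ and an injection $j\colon S_i\hookrightarrow T$, let $\pi_{j}\colon X^T\to X^{S_i}$ be the induced coordinate projection, $\pi_j((x_t)_{t\in T})=(x_{j(s)})_{s\in S_i}$, and consider the closed subset $\pi_j^{-1}(A_i)\cong A_i\times X^{T\setminus j(S_i)}$ of $X^{S_i}\times X^{T\setminus j(S_i)}\cong X^T$. The poset $P_{\mathcal A}(T)$ is the poset of strata of the natural stratification of $X^T$ determined by these subsets: it is formed by intersecting subspaces of the form $\pi_j^{-1}(A_i)$, for all $i\in I$ and all injections $j\colon S_i\hookrightarrow T$, each element being represented by the corresponding closed stratum in $X^T$. It is ordered by reverse inclusion: $B\le A$ if and only if $B\supseteq A$ as subsets of $X^T$. Its minimal element $\hat 0$ represents the whole space $X^T$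 (it corresponds to the open stratum, the complement of all the $\pi_j^{-1}(A_i)$); in particular $\hat 0\in P_{\mathcal A}(1)$ represents $X^1=X$. For finite sets $S,T$ the multiplication $P_{\mathcal A}(S)\times P_{\mathcal A}(T)\to P_{\mathcal A}(S\sqcup T)$ sends $(A,B)$ to the product $A\times B\subseteq X^S\times X^T\cong X^{S\sqcup T}$ (the product of two closed strata is again a closed stratum). Thus the map in the claim is $A\mapsto A\times X$.
   Formalization: Strata are required to be nonempty (the whole space X^T is always kept): empty intersections are discarded from P_A(T), since with them the claim fails, e.g. X = R, A_1 = {0}, A_2 = {1} in X^1, S = 1. *)

(* Defs.v *)
From HB Require Import structures.
From mathcomp Require Import all_boot all_order.
From mathcomp Require Import all_classical topology.

Set Implicit Arguments.
Unset Strict Implicit.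
Unset Printing Implicit Defensive.

Import Order.TTheory.

Local Open Scope classical_set_scope.

(* [{ptws T -> X}] is [T -> X] with the product topology, i.e. X^T. *)

Definition coord_proj (X : topologicalType) (S T : finType) (j : S -> T)
  (x : {ptws T -> X}) : {ptws S -> X} := fun s => x (j s).

(* The subset {xbar} * X of X^S under the identification of X^S with
   X^(S - {s}) * X: the points whose restriction to S - {s} is xbar. *)
Definition coord_axis (X : topologicalType) (S : finType) (s : S)
  (xbar : {ptws {t : S | t != s} -> X}) : set {ptws S -> X} :=
  [set x | coord_proj (fun t : {t : S | t != s} => val t) x = xbar].

Section Strata.
Variables (X : topologicalType) (I : finType) (S_ : I -> finType).
Variable A : forall i, set {ptws S_ i -> X}.
Arguments A : clear implicits.

Definition generating_subspaces (T : finType) : set (set {ptws T -> X}) :=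
  [set Y | exists i (j : S_ i -> T),
     injective j /\ Y = coord_proj j @^-1` A i].
Arguments generating_subspaces : clear implicits.

(* A closed stratum is the intersection of a (possibly empty) family of
   generating subspaces; the family is automatically finite.  Strata are
   nonempty, so an empty intersection is discarded, except that the whole
   space X^T is always kept: this matters only for empty X, where it makes
   \hat 0 exist for every T. *)
Definition closed_strata (T : finType) : set (set {ptws T -> X}) :=
  [set Y | (exists2 F, F `<=` generating_subspaces T & Y = \bigcap_(Z in F) Z)
           /\ (Y !=set0 \/ Y = setT)].
Arguments closed_strata : clear implicits.

Definition strata_poset (T : finType) : Type := set_type (closed_strata T).

HB.instance Definition _ (T : finType) := Choice.on (strata_poset T).

Fact strata_display : Order.disp_t. Proof. exact: Order.Disp tt tt. Qed.

Section Poset.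
Variable T : finType.

Definition strata_le (B C : strata_poset T) : bool := `[< val C `<=` val B >].

Fact strata_le_refl : reflexive strata_le.
Proof. by move=> B; apply/asboolP. Qed.

Fact strata_le_anti : antisymmetric strata_le.
Proof.
move=> B C /andP[/asboolP CB /asboolP BC]; apply: val_inj.
by apply/seteqP; split.
Qed.

Fact strata_le_trans : transitive strata_le.
Proof.
move=> C B D /asboolP CB /asboolP DC; apply/asboolP.
exact: subset_trans DC CB.
Qed.

HB.instance Definition _ := Order.Le_isPOrder.Build strata_display
  (strata_poset T) strata_le_refl strata_le_anti strata_le_trans.

Fact closed_strata_setT : setT \in closed_strata T.
Proof.
by rewrite inE; split; [exists set0; rewrite ?bigcap_set0|right].
Qed.

Definition whole_stratum : strata_poset T := exist _ setT closed_strata_setT.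

Fact whole_stratum_le (B : strata_poset T) : (whole_stratum <= B)%O.
Proof. by apply/asboolP. Qed.

HB.instance Definition _ := Order.hasBottom.Build strata_display
  (strata_poset T) whole_stratum_le.

End Poset.

(* The product of a subset of X^S and a subset of X^T, in X^(S + T). *)
Definition set_prod (S T : finType) (B : set {ptws S -> X})
    (C : set {ptws T -> X}) : set {ptws (S + T)%type -> X} :=
  [set x | B (coord_proj inl x) /\ C (coord_proj inr x)].

Fact closed_strata_prod (S T : finType) B C :
  B \in closed_strata S -> C \in closed_strata T ->
  set_prod B C \in closed_strata (S + T)%type.
Proof.
rewrite !inE => -[[F FS ->] nF] [[G GT ->] nG]; split.
  exists ([set coord_proj inl @^-1` Z | Z in F] `|`
          [set coord_proj inr @^-1` Z | Z in G]).
    move=> _ [[Z /FS[i [j [jI ->]]] <-]|[Z /GT[i [j [jI ->]]] <-]].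
      by exists i, (inl \o j); split=> // s s' [/jI].
    by exists i, (inr \o j); split=> // s s' [/jI].
  apply/seteqP; split=> x /=.
    by move=> [xF xG] _ [[Z FZ <-]|[Z GZ <-]]; [exact: xF|exact: xG].
  by move=> xFG; split=> Z ?; apply: (xFG (_ @^-1` Z)); [left|right];
    exists Z.
have [[x [xF xG]]|e0] :=
  pselect (set_prod (\bigcap_(Z in F) Z) (\bigcap_(Z in G) Z) !=set0).
  by left; exists x.
right; apply/seteqP; split=> // x _.
case: nF nG => [[y Fy]|FT] [[z Gz]|GT'].
- case: e0; exists (fun u => match u with inl s => y s | inr t => z t end).
  by split.
- case: e0; exists (fun u => match u with inl s => y s | inr t => x (inr t) end).
  by rewrite GT'; split.
- case: e0; exists (fun u => match u with inl s => x (inl s) | inr t => z t end).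
  by rewrite FT; split.
- by rewrite FT GT'; split.
Qed.

Definition strata_mul (S T : finType) (B : strata_poset S)
    (C : strata_poset T) : strata_poset (S + T)%type :=
  exist _ (set_prod (val B) (val C)) (closed_strata_prod (valP B) (valP C)).

End Strata.

Arguments generating_subspaces {X I S_} A T _.
Arguments closed_strata {X I S_} A T _.

Definition order_ideal (d : Order.disp_t) (P : porderType d) (D : set P) :=
  forall a b : P, (b <= a)%O -> D a -> D b.

(* [f] is an isomorphism of posets from [P] onto an order ideal of [Q]. *)
Definition identifies_with_order_ideal (d d' : Order.disp_t)
    (P : porderType d) (Q : porderType d') (f : P -> Q) : Prop :=
  [/\ injective f, {mono f : a b / (a <= b)%O} & order_ideal (range f)].

(* Main.v *)
(** The only possible obstruction to [B * X] having its lower set made of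
    products [D * X] is a generating subspace [pi_j^-1(A_i)] containing
    [B * X] whose injection [j] hits the added coordinate, say at [s].  Then,
    for [b] in [B], letting the added coordinate vary in [pi_j (b, x)] sweeps
    out an axis in direction [s] inside [A_i], which is excluded. *)
Require Import Defs.
From HB Require Import structures.
From mathcomp Require Import all_boot all_order.
From mathcomp Require Import all_classical topology.

Set Implicit Arguments.
Unset Strict Implicit.
Unset Printing Implicit Defensive.

Local Open Scope classical_set_scope.

Section Cylinders.
Variables (X : topologicalType) (I : finType) (S_ : I -> finType).
Variable A : forall i, set {ptws S_ i -> X}.
Arguments A : clear implicits.

(** A coordinate of a point of [X^T] would inhabit [X], so any two points agree and a nonempty
    stratum is already everything. *)
Lemma closed_strata_empty (T : finType) (Y : set {ptws T -> X}) :
  ~ inhabited X -> closed_strata A T Y -> Y = setT.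
Proof.
move=> X0 [_ [[y Yy]|//]]; apply/seteqP; split=> // z _.
suff -> : z = y by [].
by apply/funext => t; case: X0; exists; exact: z t.
Qed.

Lemma closed_strata_nonempty (T : finType) (Y : set {ptws T -> X}) :
  inhabited X -> closed_strata A T Y -> Y !=set0.
Proof. by move=> [x] [_ [//|->]]; exists (fun=> x). Qed.

Definition extend (S : finType) (b : {ptws S -> X}) (x : X) :
    {ptws (S + unit)%type -> X} :=
  fun u => if u is inl s then b s else x.

Lemma set_prod_setT (S : finType) (B : set {ptws S -> X}) :
  set_prod B (setT : set {ptws unit -> X}) = coord_proj inl @^-1` B.
Proof. by apply/seteqP; split=> [x []|x Bx]. Qed.

(** A point of [X] makes the projection along [inl] surjective, so inclusions between cylinders
    descend to their bases. *)
Lemma cylinder_subset (S : finType) (B C : set {ptws S -> X}) : inhabited X ->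
  (coord_proj (inl : S -> S + unit) @^-1` B `<=` coord_proj inl @^-1` C) <->
  B `<=` C.
Proof.
move=> [x]; split=> [BC b Bb|BC y]; last exact: BC.
exact: (BC (extend b x)).
Qed.

Lemma axis_free_factor (S : finType) (b : {ptws S -> X}) (i : I)
    (j : S_ i -> (S + unit)%type) :
  (forall (s : S_ i) (xbar : {ptws {t : S_ i | t != s} -> X}),
     ~ (coord_axis xbar `<=` A i)) ->
  injective j -> (forall x, A i (coord_proj j (extend b x))) ->
  inhabited X -> exists j' : S_ i -> S, j = inl \o j'.
Proof.
move=> no_axis jI Ab [x0].
have /choice[j' jE] : forall s, exists a, j s = inl a.
  move=> s; case js: (j s) => [a|[]]; first by exists a.
  pose xbar : {ptws {t : S_ i | t != s} -> X} :=
    coord_proj (fun t : {t : S_ i | t != s} => val t)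
      (coord_proj j (extend b x0)).
  case: (no_axis s xbar) => y yx.
  (* A point [y] of the axis through [xbar] arises by giving the added coordinate the value
     [y s]. *)
  suff -> : y = coord_proj j (extend b (y s)) by [].
  apply/funext => t; rewrite /coord_proj.
  have [->|ts] := eqVneq t s; first by rewrite js.
  have yt : y t = coord_proj j (extend b x0) t.
    exact: (congr1 (fun f => f (exist _ t ts)) yx).
  rewrite yt /coord_proj.
  (* Away from [s], injectivity keeps [j] off the added coordinate, so the entry comes from [b]
     alone and is the same for [x0] and [y s]. *)
  case jt: (j t) => [//|[]].
  by move/eqP: ts; case; apply: jI; rewrite jt js.
by exists j'; apply/funext.
Qed.

(** Every generating subspace in a family cutting out [C] contains the cylinder over [B], hence by
    [axis_free_factor] is itself a cylinder over a generating subspace of [X^S]. Intersecting these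
    bases gives [D]. *)
Lemma closed_strata_above_cylinder (S : finType) (B : set {ptws S -> X})
    (C : set {ptws (S + unit)%type -> X}) :
  (forall i (s : S_ i) (xbar : {ptws {t : S_ i | t != s} -> X}),
     ~ (coord_axis xbar `<=` A i)) ->
  inhabited X -> B !=set0 -> closed_strata A (S + unit)%type C ->
  coord_proj inl @^-1` B `<=` C ->
  exists2 D, closed_strata A S D & C = coord_proj inl @^-1` D.
Proof.
move=> no_axis X0 [b Bb] [[F FA ->] _] BC.
pose G := [set W | generating_subspaces A S W /\ F (coord_proj inl @^-1` W)].
have CE : \bigcap_(Z in F) Z = coord_proj inl @^-1` (\bigcap_(W in G) W).
  apply/seteqP; split=> [y Fy W [_]|y Gy Z FZ]; first exact: Fy.
  have [i [j [jI ZE]]] := FA _ FZ.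
  have Ab x : A i (coord_proj j (extend b x)).
    have : Z (extend b x) by exact: (BC (extend b x)).
    by rewrite ZE.
  have [j' jE] := axis_free_factor (no_axis i) jI Ab X0.
  have ZE' : Z = coord_proj inl @^-1` (coord_proj j' @^-1` A i).
    by rewrite ZE jE.
  rewrite ZE'; apply: Gy; split; last by rewrite -ZE'.
  exists i, j'; split=> // s t st; apply: jI.
  by rewrite jE /= st.
exists (\bigcap_(W in G) W) => //; split.
  by exists G => // W [].
(* The stratum [D] is nonempty because it contains [b]: any extension of [b] lies in [C]. *)
left; exists b; have [x] := X0.
have := BC (extend b x) Bb.
by rewrite CE.
Qed.

End Cylinders.

Theorem claim2p2 (X : topologicalType) (I : finType) (S_ : I -> finType)
    (A : forall i : I, set {ptws S_ i -> X})
    (A_closed : forall i : I, closed (A i))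
    (A_no_axis : forall (i : I) (s : S_ i) (xbar : {ptws {t : S_ i | t != s} -> X}),
       ~ (coord_axis xbar `<=` A i))
    (S : finType) :
  identifies_with_order_ideal
    (fun B : strata_poset A S =>
       strata_mul B (\bot%O : strata_poset A unit)).
Proof.
have valS (T : finType) (B : strata_poset A T) : closed_strata A T (val B).
  by have := valP B; rewrite inE.
have mulE (B : strata_poset A S) :
    val (strata_mul B (\bot%O : strata_poset A unit)) =
    coord_proj inl @^-1` val B.
  exact: set_prod_setT.
(* For empty [X] every stratum is the whole space, so both posets are singletons. *)
have [X0|X0] := pselect (inhabited X); last first.
  have subsingleton (T : finType) (B C : strata_poset A T) : B = C.
    apply: val_inj.
    by rewrite (closed_strata_empty X0 (valS _ B))
               (closed_strata_empty X0 (valS _ C)).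
  split=> [B C _|B C|_ C _ _]; first exact: subsingleton.
    by rewrite (subsingleton _ C B) !Order.POrderTheory.lexx.
  by exists (\bot%O : strata_poset A S) => //; exact: subsingleton.
have mono : {mono (fun B : strata_poset A S =>
    strata_mul B (\bot%O : strata_poset A unit)) : B C / (B <= C)%O}.
  move=> B C; apply/asboolP/asboolP; rewrite !mulE => BC.
    exact/(cylinder_subset _ _ X0).
  by apply/(cylinder_subset _ _ X0).
(* Reflecting the order already forces injectivity, by antisymmetry. *)
split=> //; first exact: Order.POrderTheory.inc_inj.
move=> a C /asboolP CB [B _ BE].
have BC : coord_proj inl @^-1` val B `<=` val C by rewrite -mulE BE.
have [D DS CE] := closed_strata_above_cylinder A_no_axis X0
  (closed_strata_nonempty X0 (valS _ B)) (valS _ C) BC.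
exists (exist _ D (mem_set DS)) => //.
by apply: val_inj; rewrite mulE CE.
Qed.
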